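(* Let $0<q<1$, $0<a<1$, $b>0$, $0<c<1$, $\mathcal X=\mathbb Z_{\ge0}$, and define for $x,y\in\mathcal X$ $$K(x,y)=\sum_{z=\max(x,y)}^{\infty}\pi_{qH}(x,z,c,a)\,\pi'(z,y),\qquad \pi'(z,y)=\frac{(-a^{-1}b;q)_y(a;q)_{z-y}(a^{-1}b)^{z-y}q^{\binom z2-\binom y2}}{(-b;q)_z(q;q)_{z-y}}\frac{(-b;q)_\infty}{(-a^{-1}b;q)_\infty}.$$ Then $K(x,y)\ge0$, $\sum_{x\in\mathcal X}K(x,y)=1$, and with $\pi(x)=\pi_{qM}(x,cq^{-1},(ac)^{-1}b)$ and $\check P_n(x)=\check P_{qM,n}(x,cq^{-1},(ac)^{-1}b)$, for all $x,y,n\in\mathcal X$, $$K(x,y)\,\pi(y)=K(y,x)\,\pi(x),\qquad \sum_{y\in\mathcal X}K(x,y)\,\pi(y)\,\check P_n(y)=\kappa(n)\,\pi(x)\,\check P_n(x),\qquad \kappa(n)=\frac{(c;q)_n}{(ac;q)_n}.$$ Moreover, the functions $v_n(x)=(-1)^x\frac{q^{\binom x2}}{(q;q)_x}\,\check P_{qM,n}(x,-a^{-1}bq^{-1},acb^{-1})$ form another set of eigenvectors: $\sum_{y\in\mathcal X}K(x,y)v_n(y)=\kappa^{(-)}(n)\,v_n(x)$ for all $n,x\in\mathcal X$, with $$\kappa^{(-)}(n)=\frac{(c;q)_\infty(-b;q)_\infty}{(ac;q)_\infty(-a^{-1}b;q)_\infty}\,\frac{(-a^{-1}b;q)_n}{(-b;q)_n},$$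 and $0<\kappa^{(-)}(n)<1$, $0<\kappa^{(-)}(n)/\kappa(n)<1$.
   Context: $(a;q)_n=\prod_{i=0}^{n-1}(1-aq^i)$, $(a;q)_\infty=\prod_{i\ge0}(1-aq^i)$. $q$-Hahn measure ($0<a<1$, $b<1$, integers $0\le x\le z$): $\pi_{qH}(x,z,a,b)=\frac{(q;q)_z}{(q;q)_x(q;q)_{z-x}}\frac{(a;q)_x(b;q)_{z-x}a^{z-x}}{(ab;q)_z}$. $q$-Meixner measure ($0<\beta<q^{-1}$, $\gamma>0$, $x\in\mathbb Z_{\ge0}$): $\pi_{qM}(x,\beta,\gamma)=\frac{(\beta q;q)_x}{(q;q)_x(-\beta\gamma q;q)_x}\gamma^xq^{\binom x2}\frac{(-\beta\gamma q;q)_\infty}{(-\gamma;q)_\infty}$. The functions $\check P_{qM,n}(x,\beta,\gamma)=\sum_{k=0}^{n}\frac{(q^{-n};q)_k(q^{-x};q)_k}{(\beta q;q)_k(q;q)_k}(-\gamma^{-1}q^{n+1})^k$ are defined by the same formula also for negative $\beta$. *)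

(* Defs.v *)
From HB Require Import structures.
From mathcomp Require Import all_boot all_order all_algebra.
From mathcomp Require Import all_classical all_reals all_analysis.

Set Implicit Arguments.
Unset Strict Implicit.
Unset Printing Implicit Defensive.

Import Order.TTheory GRing.Theory Num.Theory.
Import numFieldNormedType.Exports.

Local Open Scope ring_scope.
Local Open Scope classical_set_scope.

Definition qpoch {R : realType} (a q : R) (n : nat) : R :=
  \prod_(0 <= i < n) (1 - a * q ^+ i).

(* The limit exists whenever `|q| < 1. *)
Definition qpoch_inf {R : realType} (a q : R) : R := limn (qpoch a q).

(* q-Hahn weight; only meaningful for x <= z, so that z - x is not truncated. *)
Definition pi_qH {R : realType} (q : R) (x z : nat) (a b : R) : R :=
  qpoch q q z / (qpoch q q x * qpoch q q (z - x)) *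
  (qpoch a q x * qpoch b q (z - x) * a ^+ (z - x) / qpoch (a * b) q z).

Definition pi_qM {R : realType} (q : R) (x : nat) (beta gamma : R) : R :=
  qpoch (beta * q) q x / (qpoch q q x * qpoch (- (beta * gamma * q)) q x) *
  gamma ^+ x * q ^+ 'C(x, 2) *
  (qpoch_inf (- (beta * gamma * q)) q / qpoch_inf (- gamma) q).

Definition P_qM {R : realType} (q : R) (n x : nat) (beta gamma : R) : R :=
  \sum_(0 <= k < n.+1)
    qpoch (q ^- n) q k * qpoch (q ^- x) q k /
    (qpoch (beta * q) q k * qpoch q q k) *
    (- (gamma^-1 * q ^+ n.+1)) ^+ k.

(* Only meaningful for y <= z; the exponent of q is a difference in int. *)
Definition pi_prime {R : realType} (q a b : R) (z y : nat) : R :=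
  qpoch (- (a^-1 * b)) q y * qpoch a q (z - y) * (a^-1 * b) ^+ (z - y) *
  q ^ ('C(z, 2)%:Z - 'C(y, 2)%:Z) /
  (qpoch (- b) q z * qpoch q q (z - y)) *
  (qpoch_inf (- b) q / qpoch_inf (- (a^-1 * b)) q).

Definition Kterm {R : realType} (q a b c : R) (x y z : nat) : R :=
  pi_qH q x z c a * pi_prime q a b z y.

Definition K {R : realType} (q a b c : R) (x y : nat) : R :=
  limn (fun m => \sum_(maxn x y <= z < m) Kterm q a b c x y z).

Definition kappa {R : realType} (q a c : R) (n : nat) : R :=
  qpoch c q n / qpoch (a * c) q n.

Definition kappa_minus {R : realType} (q a b c : R) (n : nat) : R :=
  (qpoch_inf c q * qpoch_inf (- b) q) /
  (qpoch_inf (a * c) q * qpoch_inf (- (a^-1 * b)) q) *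
  (qpoch (- (a^-1 * b)) q n / qpoch (- b) q n).

Definition v {R : realType} (q a b c : R) (n x : nat) : R :=
  (-1) ^+ x * (q ^+ 'C(x, 2) / qpoch q q x) *
  P_qM q n x (- (a^-1 * b * q^-1)) (a * c * b^-1).

(* Main.v *)
Require Import Defs.
From HB Require Import structures.
From mathcomp Require Import all_boot all_order all_algebra.
From mathcomp Require Import all_classical all_reals all_analysis.
From mathcomp Require Import ring lra.

Set Implicit Arguments.
Unset Strict Implicit.
Unset Printing Implicit Defensive.

Import Order.TTheory GRing.Theory Num.Theory.
Import numFieldNormedType.Exports.

Local Open Scope ring_scope.
Local Open Scope classical_set_scope.

(* The q-Hahn factor maps [(q^-y;q)_k / (c;q)_k] to [(q^-z;q)_k / (ac;q)_k] by q-Vandermonde, so it turns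
   the q-Meixner function [P_n] with parameter [c] into the one with parameter [ac]. The factor [pi_prime] maps
   the product of [b + q^(i+1-z)] over [i < k] to the product of [b/a + q^(i+1-x)], by the summation formula
   for 1phi1. Heine's transformation rewrites both q-Meixner functions in these product bases with the same
   coefficients, up to the normalizations [(ac;q)_n] and [(c;q)_n], whose ratio is [kappa n]; detailed balance
   carries this over to [K]. For the second family of eigenvectors the two factors exchange roles, with
   [(b, c)] replaced by [(- ac, - b/a)]. All interchanges of sums are controlled by [q^binom(z,2)]. *)

(** * Terminating q-series *)

Section QAlgebra.
Variables (R : realType) (q : R).
Hypothesis hq : 0 < q < 1.

Lemma q_neq0 : q != 0.
Proof. by case/andP: hq => q0 _; rewrite gt_eqF. Qed.

Lemma qexp_neq0 n : q ^+ n != 0.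
Proof. by rewrite expf_neq0 // q_neq0. Qed.

Lemma qpoch0 (a : R) : qpoch a q 0 = 1.
Proof. by rewrite /qpoch big_nil. Qed.

Lemma qpochS (a : R) n : qpoch a q n.+1 = qpoch a q n * (1 - a * q ^+ n).
Proof. by rewrite /qpoch big_nat_recr. Qed.

Lemma qpochSl (a : R) n : qpoch a q n.+1 = (1 - a) * qpoch (a * q) q n.
Proof.
rewrite /qpoch big_nat_recl // expr0 mulr1; congr (_ * _).
by apply: eq_bigr => i _; rewrite exprS mulrA.
Qed.

Lemma qpochD (a : R) m n :
  qpoch a q (m + n) = qpoch a q m * qpoch (a * q ^+ m) q n.
Proof.
elim: n => [|n IHn]; first by rewrite addn0 qpoch0 mulr1.
by rewrite addnS !qpochS IHn exprD !mulrA.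
Qed.

Lemma qpoch_gt0 (a : R) n : a < 1 -> 0 < qpoch a q n.
Proof.
case/andP: hq => q0 q1 a1; apply: prodr_gt0 => i _; rewrite subr_gt0.
have [a0|a0] := ltP 0 a.
  by apply: le_lt_trans a1; rewrite ler_piMr ?exprn_ile1 // ltW.
by apply: le_lt_trans ltr01; rewrite mulr_le0_ge0 // exprn_ge0 // ltW.
Qed.

Lemma qpoch_neq0 (a : R) n : a < 1 -> qpoch a q n != 0.
Proof. by move=> a1; rewrite gt_eqF // qpoch_gt0. Qed.

Lemma qq_neq0 n : qpoch q q n != 0.
Proof. by case/andP: hq => _ q1; exact: qpoch_neq0. Qed.

Lemma one_subq_neq0 n : 1 - q ^+ n.+1 != 0.
Proof.
by have := qq_neq0 n.+1; rewrite qpochS -exprS mulf_eq0 negb_or => /andP[].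
Qed.

Lemma bin2S k : 'C(k.+1, 2) = ('C(k, 2) + k)%N.
Proof. by rewrite binS bin1 addnC. Qed.

(** The Gaussian binomial coefficient. The value 0 for [k > n] is imposed because the truncated
    [n - k] would give something else; it lets the Pascal rules hold for all [k]. *)
Definition qbin n k : R :=
  if (k <= n)%N then qpoch q q n / (qpoch q q k * qpoch q q (n - k)) else 0.

Lemma qbinn0 n : qbin n 0 = 1.
Proof. by rewrite /qbin leq0n subn0 qpoch0 mul1r divff // qq_neq0. Qed.

Lemma qbin_small n k : (n < k)%N -> qbin n k = 0.
Proof. by rewrite ltnNge /qbin => /negbTE ->. Qed.

(** The ratio of neighbouring coefficients, multiplied out so that it stays true for [k >= n], where
    both sides vanish. *)
Lemma qbin_shift n k :
  qbin n k.+1 * (1 - q ^+ k.+1) = qbin n k * (1 - q ^+ (n - k)).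
Proof.
rewrite /qbin; case: ltngtP => [lt_kn|lt_nk|->].
- rewrite -subn_gt0 in lt_kn.
  rewrite subnS; case: (n - k)%N lt_kn => // m _ /=.
  rewrite !qpochS -!exprS.
  have := one_subq_neq0 k; have := one_subq_neq0 m.
  move: (1 - q ^+ k.+1) (1 - q ^+ m.+1) => s t t0 s0; field.
  by rewrite !qq_neq0 s0 t0.
- by rewrite !mul0r.
- by rewrite subnn expr0 subrr mulr0 mul0r.
Qed.

Lemma qbinS n k : qbin n.+1 k.+1 = q ^+ k.+1 * qbin n k.+1 + qbin n k.
Proof.
rewrite /qbin ltnS; case: ltngtP => [lt_kn|lt_nk|->].
- rewrite subSS; move: (lt_kn); rewrite -subn_gt0 subnS.
  case E: (n - k)%N => [|m] // _ /=.
  have -> : n = (k + m.+1)%N by rewrite -E subnKC // ltnW.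
  rewrite !qpochS -!exprS -addSn exprD.
  have := one_subq_neq0 k; have := one_subq_neq0 m.
  move: (q ^+ k.+1) (q ^+ m.+1) => s t t0 s0; field.
  by rewrite !qq_neq0 s0 t0.
- by rewrite mulr0 addr0.
- by rewrite mulr0 add0r !subnn qpoch0 !mulr1 !divff ?qq_neq0.
Qed.

Lemma qbinS' n k : qbin n.+1 k.+1 = qbin n k.+1 + q ^+ (n - k) * qbin n k.
Proof.
apply: (addIr (- (q ^+ k.+1 * qbin n k.+1 + qbin n k))).
rewrite -{1}qbinS subrr.
have := qbin_shift n k => /(congr1 (fun t => t - qbin n k * (1 - q ^+ (n - k)))).
by rewrite subrr => <-; ring.
Qed.

(** Pascal's rule under a sum: inductions on [n] can then compare summands of equal index without
    reindexing. *)
Lemma sum_qbinS n (F : nat -> R) :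
  \sum_(k < n.+2) qbin n.+1 k * F k =
  \sum_(k < n.+1) qbin n k * (q ^+ k * F k + F k.+1).
Proof.
rewrite big_ord_recl /= qbinn0 mul1r.
under eq_bigr => i _ do rewrite /bump add1n qbinS mulrDl.
rewrite big_split /= addrA.
under [in RHS]eq_bigr => i _ do rewrite mulrDr.
rewrite [RHS]big_split /=; congr (_ + _).
transitivity (\sum_(k < n.+2) qbin n k * (q ^+ k * F k)).
  rewrite [RHS]big_ord_recl /= qbinn0 expr0 !mul1r; congr (_ + _).
  by apply: eq_bigr => i _; rewrite /bump add1n; ring.
by rewrite big_ord_recr /= qbin_small // mul0r addr0.
Qed.

Lemma sum_qbinS' n (F : nat -> R) :
  \sum_(k < n.+2) qbin n.+1 k * F k =
  \sum_(k < n.+1) qbin n k * (F k + q ^+ (n - k) * F k.+1).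
Proof.
rewrite big_ord_recl /= qbinn0 mul1r.
under eq_bigr => i _ do rewrite /bump add1n qbinS' mulrDl.
rewrite big_split /= addrA.
under [in RHS]eq_bigr => i _ do rewrite mulrDr.
rewrite [RHS]big_split /=; congr (_ + _).
  transitivity (\sum_(k < n.+2) qbin n k * F k).
    by rewrite [RHS]big_ord_recl /= qbinn0 mul1r.
  by rewrite big_ord_recr /= qbin_small // mul0r addr0.
by apply: eq_bigr => i _; ring.
Qed.

(** Induction on [n]: after [sum_qbinS'] each summand acquires the factor
    [(1 - c q^(n-k)) + c q^(n-k) (1 - a q^k)], which is [1 - a c q^n] whatever [k] is. *)
Lemma q_vandermonde (a c : R) n :
  \sum_(k < n.+1) qbin n k * (qpoch a q k * c ^+ k * qpoch c q (n - k)) =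
  qpoch (a * c) q n.
Proof.
elim: n => [|n IHn].
  by rewrite big_ord1 qbinn0 !qpoch0 expr0 !mulr1.
rewrite (sum_qbinS' n (fun k => qpoch a q k * c ^+ k * qpoch c q (n.+1 - k))).
rewrite qpochS -IHn mulr_suml; apply: eq_bigr => -[k /= lkn] _.
rewrite ltnS in lkn.
rewrite subSS subSn // !qpochS exprS.
have -> : q ^+ n = q ^+ k * q ^+ (n - k) by rewrite -exprD subnKC.
ring.
Qed.

(** The homogeneous form of [W^k (Y/W;q)_k], polynomial in [W] and [Y]. *)
Definition wprod (W Y : R) k := \prod_(0 <= i < k) (W - Y * q ^+ i).

Lemma wprodS W Y k : wprod W Y k.+1 = wprod W Y k * (W - Y * q ^+ k).
Proof. by rewrite /wprod big_nat_recr. Qed.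

Lemma wprodSl W Y k : wprod W Y k.+1 = (W - Y) * wprod W (q * Y) k.
Proof.
rewrite /wprod big_nat_recl // expr0 mulr1; congr (_ * _).
by apply: eq_bigr => i _; rewrite exprS mulrA (mulrC Y).
Qed.

Lemma wprod_scale s W Y k : wprod (s * W) (s * Y) k = s ^+ k * wprod W Y k.
Proof.
elim: k => [|k IHk]; first by rewrite /wprod !big_nil mulr1.
by rewrite !wprodS IHk exprS; ring.
Qed.

Lemma wprod_qpoch W X k : wprod W (X * W) k = W ^+ k * qpoch X q k.
Proof.
elim: k => [|k IHk]; first by rewrite /wprod big_nil qpoch0 mulr1.
by rewrite wprodS qpochS IHk exprS; ring.
Qed.

Definition heine_term n (Y W C : R) k :=
  (-1) ^+ k * q ^+ 'C(k, 2) * wprod W Y k * qpoch (C * q ^+ k) q (n - k).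

(** This is [(C;q)_n] times the 2phi1 series with upper parameters [q^-n], [Y/W], lower parameter
    [C] and argument [q^n W], written as a polynomial so that [W] and [C] can be exchanged without
    side conditions. *)
Definition heine n (Y W C : R) :=
  \sum_(k < n.+1) qbin n k * heine_term n Y W C k.

(** Pascal's rule leaves the bracket [(1 - W) - (C - Y) q^k] in each summand; powers of [q^k] are
    absorbed by scaling [Y] and [W], as [wprod] is homogeneous. *)
Lemma heineS n Y W C :
  heine n.+1 Y W C =
  (1 - W) * heine n (q * Y) (q * W) (q * C) -
  (C - Y) * heine n (q ^+ 2 * Y) (q ^+ 2 * W) (q * C).
Proof.
rewrite /heine sum_qbinS !mulr_sumr -sumrB; apply: eq_bigr => -[k /= lkn] _.
rewrite ltnS in lkn.
rewrite /heine_term !wprod_scale bin2S subSS subSn // qpochSl wprodS.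
rewrite [C * q ^+ k.+1]mulrC exprS [q * C * _]mulrAC.
rewrite [C * q ^+ k * q](_ : _ = q * q ^+ k * C); last by ring.
by rewrite exprD [_ ^+ k.+1]exprS -exprM mulnC exprM; ring.
Qed.

(** Given symmetry at [n], this relation is exactly what separates the recurrence [heineS] from its
    image under the exchange of [W] and [C]. *)
Lemma heine_contiguous n Y W C :
  (C - W) * heine n Y W C =
  (C - Y) * heine n (q * Y) (q * W) C - (W - Y) * heine n (q * Y) W (q * C).
Proof.
apply/eqP; rewrite -subr_eq0; apply/eqP.
(* The difference of the two sides telescopes with certificate [A]. *)
pose A k := qbin n k * heine_term n Y W C k * (C * (1 - q ^+ k)).
have A0 : A 0%N = 0 by rewrite /A expr0 subrr !mulr0.
have An : A n.+1 = 0 by rewrite /A qbin_small // !mul0r.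
transitivity (\sum_(k < n.+1) (A k - A k.+1)); last first.
  rewrite -(big_mkord xpredT (fun k => A k - A k.+1)).
  rewrite -[RHS]oppr0 -[X in - X](_ : A n.+1 - A 0%N = 0); last by rewrite A0 An subrr.
  by rewrite -telescope_sumr // -sumrN; apply: eq_bigr => i _; rewrite opprB.
rewrite /heine !mulr_sumr -!sumrB; apply: eq_bigr => -[k /= lkn] _.
rewrite ltnS in lkn.
have qsh := qbin_shift n k.
rewrite /A -[qbin n k.+1 * _ * _](_ :
  qbin n k.+1 * (1 - q ^+ k.+1) * heine_term n Y W C k.+1 * C = _); last by ring.
rewrite qsh /heine_term wprod_scale wprodS bin2S.
have wE : (W - Y) * wprod W (q * Y) k = wprod W Y k * (W - Y * q ^+ k).
  by rewrite -wprodSl wprodS.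
rewrite [(-1) ^+ k.+1]exprS exprD.
rewrite [X in _ - (_ - X)](_ : _ = qbin n k * ((-1) ^+ k * q ^+ 'C(k, 2) *
  ((W - Y) * wprod W (q * Y) k) * qpoch (q * C * q ^+ k) q (n - k))); last by ring.
rewrite wE.
(* The case [k = n] is apart because [n - k.+1] is truncated there; the factor [1 - q ^+ (n - k)]
   kills the term that contains it. *)
move: lkn; rewrite leq_eqVlt => /orP[/eqP->|lkn].
  by rewrite subnn !qpoch0 expr0; ring.
have E : (n - k = (n - k.+1).+1)%N by rewrite -subSn.
rewrite [X in qpoch (q * C * q ^+ k) q X]E qpochS.
rewrite [X in qpoch (C * q ^+ k) q X]E qpochSl E.
rewrite [q * C * q ^+ k](_ : _ = C * q ^+ k.+1); last by rewrite exprS; ring.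
rewrite [C * q ^+ k * q](_ : _ = C * q ^+ k.+1); last by rewrite exprS; ring.
rewrite !exprS; ring.
Qed.

(* Heine's transformation of a terminating 2phi1, with denominators cleared (see [P_qM_heine]). *)
Lemma heine_sym n Y W C : heine n Y W C = heine n Y C W.
Proof.
elim: n Y W C => [|n IHn] Y W C.
  by rewrite /heine !big_ord1 /heine_term /wprod !big_nil !qpoch0.
rewrite !heineS [heine n (q * Y) (q * C) _]IHn [heine n _ (q ^+ 2 * C) _]IHn.
have := heine_contiguous n (q * Y) (q * W) (q * C).
rewrite !mulrA -!expr2 -!mulrBr -!mulrA -mulrBr => /(mulfI q_neq0) E.
apply/eqP; rewrite -subr_eq0; apply/eqP.
move: E; move: (heine _ _ _ _) (heine _ _ _ _) (heine _ _ _ _) => s3 s2 s1 E.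
transitivity ((C - W) * s1 - ((C - Y) * s2 - (W - Y) * s3)); first by ring.
by rewrite E subrr.
Qed.

(** A finite form of the 1phi1 summation, obtained from Heine's transformation at [Y = C];
    [sum_1phi1] is its limit as [n] grows. *)
Lemma sum_1phi1_fin (a u : R) n :
  \sum_(k < n.+1) qbin n k * (qpoch a q k * u ^+ k * q ^+ 'C(k, 2) *
    qpoch (- (a * u * q ^+ k)) q (n - k)) = qpoch (- u) q n.
Proof.
transitivity (heine n (a * - u) (- u) (a * - u)).
  apply: eq_bigr => k _; rewrite /heine_term wprod_qpoch; congr (_ * _).
  rewrite mulrN mulNr (exprNn u).
  rewrite [X in _ = X * _](_ : _ = ((-1) ^+ k) ^+ 2 * (q ^+ 'C(k, 2) * u ^+ k * qpoch a q k)); last by ring.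
  rewrite sqrr_sign; ring.
(* After the exchange [W] equals [Y], so every product with [k > 0] contains a zero factor and only
   [k = 0] survives. *)
rewrite heine_sym /heine big_ord_recl /= big1 => [|i _].
  by rewrite qbinn0 /heine_term /wprod big_nil expr0 subn0 bin0n !mulr1 !mul1r addr0.
by rewrite /heine_term /bump add1n wprodSl subrr mul0r !(mulr0, mul0r).
Qed.

(** * q-Meixner functions and moments of the q-Hahn weight *)

Lemma qpoch_qVn n k : (k <= n)%N ->
  qpoch (q ^- n) q k = (-1) ^+ k * q ^+ 'C(k, 2) / q ^+ (n * k) *
    (qpoch q q n / qpoch q q (n - k)).
Proof.
elim: k => [|k IHk] lkn.
  by rewrite qpoch0 subn0 divff ?qq_neq0 // muln0 bin0n !expr0 invr1 !mulr1.
rewrite qpochS IHk ?(ltnW lkn) // bin2S mulnS !exprD.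
have E : (n - k = (n - k.+1).+1)%N by rewrite -subSn.
rewrite E qpochS -exprS -E exprS.
have -> : q ^+ n = q ^+ (n - k) * q ^+ k by rewrite -exprD subnK // ltnW.
field.
by rewrite !qexp_neq0 E one_subq_neq0 qq_neq0.
Qed.

Lemma qpoch_qVn0 n k : (n < k)%N -> qpoch (q ^- n) q k = 0.
Proof.
move=> lnk; rewrite -(subnKC lnk) qpochD qpochS mulVf ?qexp_neq0 // subrr.
by rewrite mulr0 mul0r.
Qed.

(** Matching the argument [- (g^-1 * q ^+ n.+1)] with [W * q ^+ n] forces [W = - (q / g)]; then
    [Y / W = q^-x]. *)
Lemma P_qM_heine n x (C g : R) : g != 0 -> (forall k, qpoch C q k != 0) ->
  qpoch C q n * P_qM q n x (C * q^-1) g =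
  heine n (q ^- x * (- (q / g))) (- (q / g)) C.
Proof.
move=> g0 C0; rewrite /P_qM big_mkord mulr_sumr; apply: eq_bigr => -[k /= lkn] _.
rewrite ltnS in lkn.
rewrite divfK ?q_neq0 // /heine_term wprod_qpoch /qbin lkn.
have -> : qpoch C q n = qpoch C q k * qpoch (C * q ^+ k) q (n - k).
  by rewrite -qpochD subnKC.
rewrite qpoch_qVn // exprS.
rewrite (_ : - (g^-1 * (q * q ^+ n)) = - (q / g) * q ^+ n); last by field.
rewrite exprMn -exprM.
move: (- (q / g)) => W; field.
by rewrite C0 !qq_neq0 qexp_neq0.
Qed.

(* The [y]-dependence of [(q^-y;q)_k] shifts [c] to [c q^k] in the q-Vandermonde sum. *)
Lemma pi_qH_moment (a c : R) z k : (forall m, qpoch (a * c) q m != 0) ->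
  \sum_(y < z.+1) pi_qH q y z c a * qpoch (q ^- y) q k =
  qpoch c q k / qpoch (a * c) q k * qpoch (q ^- z) q k.
Proof.
move=> ac0.
have [lzk|lkz] := ltnP z k.
  rewrite qpoch_qVn0 // mulr0 big1 // => -[y /= lyz] _.
  by rewrite qpoch_qVn0 ?mulr0 //; exact: leq_trans lyz _.
rewrite -(big_mkord xpredT (fun y => pi_qH q y z c a * qpoch (q ^- y) q k)).
rewrite (big_cat_nat _ (n := k)) //=; last exact: leq_trans lkz _.
rewrite big_nat big1 ?add0r => [|y /andP[_ lyk]]; last first.
  by rewrite qpoch_qVn0 ?mulr0.
rewrite -{1}[k]add0n big_addn subSn // big_mkord.
(* The terms [y < k] are gone; the reversed index is [j = z - y], the exponent of [c] in [pi_qH],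
   which is the summation index of [q_vandermonde]. *)
rewrite (reindex_inj rev_ord_inj) /=.
have E := q_vandermonde a (c * q ^+ k) (z - k).
rewrite qpoch_qVn //.
have D : qpoch (a * c) q z = qpoch (a * c) q k * qpoch (a * c * q ^+ k) q (z - k).
  by rewrite -qpochD subnKC.
rewrite (mulrA a) in E.
transitivity (qpoch q q z / qpoch q q (z - k) / qpoch (a * c) q z * qpoch c q k *
    ((-1) ^+ k * q ^+ 'C(k, 2) / q ^+ (z * k)) * qpoch (a * c * q ^+ k) q (z - k)); last first.
  have := ac0 z; rewrite D mulf_eq0 negb_or => /andP[_ D'].
  by field; rewrite !qexp_neq0 !qq_neq0 ac0.
rewrite -E mulr_sumr; apply: eq_bigr => -[j /= ljz] _.
rewrite ltnS in ljz.
rewrite /bump /= /qbin ljz /pi_qH subSS.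
have Ez : (z = k + (z - k - j) + j)%N by rewrite -addnA subnK // subnKC.
have -> : (z - (z - k - j + k) = j)%N by rewrite {1}Ez addnC [(k + _)%N]addnC addnK.
rewrite qpoch_qVn ?leq_addl // addnK [(z - k - j + k)%N]addnC (qpochD c) exprMn.
rewrite (mulrC c a).
have -> : q ^+ (z * k) = q ^+ ((k + (z - k - j)) * k) * (q ^+ k) ^+ j.
  by rewrite -exprM -exprD [(k * j)%N]mulnC -mulnDl -Ez.
field.
by rewrite !qexp_neq0 !qq_neq0 ac0 -exprM qexp_neq0.
Qed.

(** Only [(q^-y;q)_k] depends on [y], so [pi_qH_moment] applies term by term and trades the
    denominator [(c;q)_k] for [(ac;q)_k]. *)
Lemma pi_qH_P_qM (a c g : R) n z : (forall m, qpoch c q m != 0) ->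
  (forall m, qpoch (a * c) q m != 0) ->
  \sum_(y < z.+1) pi_qH q y z c a * P_qM q n y (c * q^-1) g =
  P_qM q n z (a * c * q^-1) g.
Proof.
move=> c0 ac0; rewrite /P_qM.
under eq_bigr => y _ do rewrite mulr_sumr.
rewrite exchange_big /=; apply: eq_bigr => k _.
rewrite !divfK ?q_neq0 //.
transitivity (qpoch (q ^- n) q k / (qpoch c q k * qpoch q q k) *
    (- (g^-1 * q ^+ n.+1)) ^+ k *
    \sum_(y < z.+1) pi_qH q y z c a * qpoch (q ^- y) q k).
  by rewrite mulr_sumr; apply: eq_bigr => y _; ring.
rewrite pi_qH_moment //; field.
by rewrite qq_neq0 ac0 c0.
Qed.

End QAlgebra.

(** * Series dominated by M^k q^binom(k,2) *)

Section Series.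
Variable R : realType.

Lemma cvg_dist_le (u v : nat -> R) (l : R) :
  (forall n, `|u n - l| <= v n) -> v @ \oo --> (0 : R) -> u @ \oo --> l.
Proof.
move=> uv v0; apply/subr_cvg0; apply: norm_cvg0.
apply: (squeeze_cvgr _ (cvg_cst (0 : R)) v0).
by near=> n; rewrite normr_ge0 uv.
Unshelve. all: by end_near. Qed.

Lemma cvg_series_linear (m : nat) (d : nat -> R) (F : nat -> nat -> R) (l : nat -> R) :
  (forall j, series (fun k => F k j) @ \oo --> l j) ->
  series (fun k => \sum_(j < m) d j * F k j) @ \oo --> \sum_(j < m) d j * l j.
Proof.
move=> Fl.
rewrite (_ : series _ = (fun N => \sum_(j < m) d j * series (fun k => F k j) N)); last first.
  apply/funext => N; rewrite seriesEnat /= exchange_big /=; apply: eq_bigr => j _.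
  by rewrite mulr_sumr.
apply: cvg_big => [|j _]; [exact: add_continuous|by apply: cvgMr].
Qed.

Lemma cvg_series_shift (f : nat -> R) x (l : R) : (forall z, (z < x)%N -> f z = 0) ->
  series (fun k => f (x + k)%N) @ \oo --> l -> series f @ \oo --> l.
Proof.
move=> f0; rewrite -(cvg_shiftn x (series f)) /=.
rewrite (_ : (fun n => series f (n + x)) = series (fun k => f (x + k)%N)) //.
apply/funext => n; rewrite !seriesEnat /= (big_cat_nat _ (n := x)) ?leq_addl //=.
rewrite big_nat big1 ?add0r => [|z /andP[_ /f0]] //.
by rewrite -{1}[x]add0n big_addn addnK; apply: eq_bigr => k _; rewrite addnC.
Qed.

Definition gauss (q M : R) (k : nat) : R := M ^+ k * q ^+ 'C(k, 2).

Lemma gauss_ge0 (q M : R) k : 0 <= q -> 0 <= M -> 0 <= gauss q M k.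
Proof. by move=> q0 M0; rewrite mulr_ge0 ?exprn_ge0. Qed.

Lemma gaussM (q M N : R) k : gauss q (M * N) k = gauss q M k * N ^+ k.
Proof. by rewrite /gauss exprMn mulrAC. Qed.

(** The ratio of consecutive terms is [M q^k], which tends to 0: from some [k0] on the sequence
    decreases, and the sum of the terms up to [k0] is a bound. *)
Lemma gauss_bounded (q M : R) : 0 < q < 1 -> 0 <= M ->
  exists2 D, 0 <= D & forall k, gauss q M k <= D.
Proof.
case/andP=> q0 q1 M0.
have g0 k : 0 <= gauss q M k by rewrite gauss_ge0 // ltW.
have Mq : (fun k => M * q ^+ k) @ \oo --> (0 : R).
  by rewrite -[X in _ --> X](mulr0 M); apply: cvgMr; apply: cvg_expr; rewrite gtr0_norm.
have [k0 _ Hk0] := cvgr_le _ Mq _ ltr01.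
exists (\sum_(k < k0.+1) gauss q M k) => [|k]; first by apply: sumr_ge0 => i _.
have below j : (j <= k0)%N -> gauss q M j <= \sum_(k < k0.+1) gauss q M k.
  rewrite -ltnS => jk0; rewrite (bigD1 (Ordinal jk0)) //= lerDl.
  by apply: sumr_ge0 => i _.
elim: k => [|k IHk]; first exact: below.
have [/below//|k0k] := leqP k.+1 k0.
apply: le_trans IHk; rewrite /gauss bin2S exprS exprD.
have /= Hk := Hk0 k k0k.
rewrite (_ : _ * _ = (M * q ^+ k) * gauss q M k); last by rewrite /gauss; ring.
by rewrite -/(gauss q M k) ler_piMl.
Qed.

Lemma gauss_summable (q M : R) : 0 < q < 1 -> 0 <= M ->
  cvgn (series (gauss q M)).
Proof.
move=> hq M0; have [q0 q1] := andP hq.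
(* A bound for the parameter [2 * M] is a geometric majorant [D * 2^-k] for the parameter [M]. *)
have [|D D0 HD] := @gauss_bounded q (2 * M) hq; first by rewrite mulr_ge0.
apply: (@series_le_cvg _ _ (geometric D (2^-1))).
- by move=> k; apply: gauss_ge0 => //; exact: ltW.
- by move=> k; apply: geometric_ge0.
- move=> k; rewrite /geometric /= exprVn ler_pdivlMr ?exprn_gt0 //.
  by apply: le_trans (HD k); rewrite /gauss exprMn; lra.
- apply: is_cvg_geometric_series; rewrite gtr0_norm ?invr_gt0 //.
  by rewrite invf_lt1 // ltr1n.
Qed.

(** Row [z] has at most [z + 1] nonzero entries under one Gaussian bound, so the first [N] rows and
    the first [N] columns have sums whose difference tends to 0. The limit over rows thus passes to
    the columns. *)
Lemma triangular_fubini (q C M : R) (F : nat -> nat -> R) (l : R) :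
  0 < q < 1 -> 0 <= C -> 0 <= M ->
  (forall z y, (z < y)%N -> F z y = 0) ->
  (forall z y, (y <= z)%N -> `|F z y| <= C * gauss q M z) ->
  series (fun z => \sum_(y < z.+1) F z y) @ \oo --> l ->
  (forall y, cvgn (series (F^~ y))) /\
  series (fun y => limn (series (F^~ y))) @ \oo --> l.
Proof.
move=> hq C0 M0 F0 FC Fl; have [q0 q1] := andP hq.
have g0 (N : R) k : 0 <= N -> 0 <= gauss q N k by move=> N0; rewrite gauss_ge0 // ltW.
have FC' z y : `|F z y| <= C * gauss q M z.
  by have [/F0->|/FC//] := ltnP z y; rewrite normr0 mulr_ge0 // g0.
have cF y : cvgn (series (F^~ y)).
  apply: normed_cvg; apply: (@series_le_cvg _ _ (fun z => C * gauss q M z)) => //=.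
  - by move=> z; rewrite mulr_ge0 // g0.
  - rewrite (_ : series _ = (fun n => C * series (gauss q M) n)).
      by apply: is_cvgMr; exact: gauss_summable.
    by apply/funext => n; rewrite !seriesEnat /= mulr_sumr.
split=> //.
pose T := series (gauss q (2 * M)).
have cT : cvgn T by apply: gauss_summable => //; rewrite mulr_ge0.
have ndT : nondecreasing_seq T.
  apply/nondecreasing_seqP => n; rewrite /T seriesSr lerDl g0 // mulr_ge0 //.
apply: (@cvg_dist_le _ (fun N => `|series (fun z => \sum_(y < z.+1) F z y) N - l| +
    C * (limn T - T N))); last first.
  rewrite -[X in _ --> X](addr0 0); apply: cvgD.
    rewrite -[X in _ --> X](normr0 R); apply: cvg_norm.
    by rewrite -[X in _ --> X](subrr l); apply: cvgB => //; exact: cvg_cst.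
  rewrite -[X in _ --> X](mulr0 C) -(subrr (limn T)); apply: cvgMr.
  by apply: cvgB => //; exact: cvg_cst.
move=> N /=.
set H := series _ N; set rows := series _ N.
rewrite (_ : H - l = (rows - l) + (H - rows)); last by ring.
apply: le_trans (ler_normD _ _) _. rewrite lerD2l.
(* The rows [z >= N] contribute at most [N * sum_(z >= N) C * gauss q M z], and [N <= z <= 2 ^ z]
   absorbs the factor [N]. *)
have HE : (fun m => \sum_(0 <= y < N) series (F^~ y) m) @ \oo --> H.
  rewrite /H seriesEnat /=; by apply: cvg_big => [|y _]; [exact: add_continuous|exact: cF].
have HB : (fun m => `|\sum_(0 <= y < N) series (F^~ y) m - rows|) @ \oo --> `|H - rows|.
  by apply: cvg_norm; apply: cvgB => //; exact: cvg_cst.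
rewrite -(cvg_lim _ HB) //; apply: limr_le; first by apply/cvg_ex; exists (`|H - rows|).
exists N => // m /= Nm.
(* The first [N] rows fill just the square [y, z < N], since [F] vanishes for [y > z]; only the
   block [y < N <= z < m] is left to bound. *)
have rowsE : rows = \sum_(0 <= y < N) series (F^~ y) N.
  rewrite /rows seriesEnat /= [RHS](eq_bigr (fun y => \sum_(0 <= z < N) F z y)); last first.
    by move=> y _; rewrite seriesEnat.
  rewrite [RHS]exchange_big_nat /= !big_nat; apply: eq_bigr => z /andP[_ zN].
  rewrite -(big_mkord xpredT (F z)) [RHS](big_cat_nat _ (n := z.+1)) //= [X in _ + X]big1_seq ?addr0 //.
  by move=> y; rewrite mem_index_iota => /andP[_ /andP[zy _]]; exact: F0.
rewrite rowsE -sumrB.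
apply: (@le_trans _ _ (\sum_(0 <= y < N) \sum_(N <= z < m) C * gauss q M z)).
  apply: le_trans (ler_norm_sum _ _ _) _; apply: ler_sum => y _.
  rewrite sub_series_geq //; apply: le_trans (ler_norm_sum _ _ _) _.
  by apply: ler_sum => z _; exact: FC'.
apply: (@le_trans _ _ (\sum_(N <= z < m) C * gauss q (2 * M) z)); last first.
  rewrite -mulr_sumr ler_wpM2l // -sub_series_geq // lerD2r.
  exact: nondecreasing_cvgn_le.
rewrite sumr_const_nat subn0 -sumrMnl; apply: ler_sum_nat => z /andP[Nz _].
rewrite -mulrnAr ler_wpM2l // /gauss exprMn -mulrA -[X in X <= _]mulr_natl.
rewrite ler_wpM2r ?g0 // -natrX ler_nat (leq_trans Nz) //.
by apply: ltnW; rewrite ltn_expl.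
Qed.

End Series.

(** * Infinite q-Pochhammer symbols *)

Section QPochInf.
Variables (R : realType) (q : R).
Hypothesis hq : 0 < q < 1.

Let q0 : 0 < q. Proof. by case/andP: hq. Qed.
Let q1 : 0 < 1 - q. Proof. by rewrite subr_gt0; case/andP: hq. Qed.
Let ql1 : q < 1. Proof. by case/andP: hq. Qed.
Let qn0 n : 0 < q ^+ n. Proof. by rewrite exprn_gt0. Qed.
Let qn1 n : q ^+ n <= 1.
Proof. by rewrite exprn_ile1 ?ltW // -subr_gt0. Qed.

(** The exponent is the sum of all [|w| q^i]; each factor obeys [|1 - w q^i| <= exp(|w| q^i)]. *)
Definition qpoch_majorant (w : R) := expR (`|w| / (1 - q)).

Lemma qpoch_norm_le w n : `|qpoch w q n| <= qpoch_majorant w.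
Proof.
(* The induction needs the partial geometric sum in the exponent. *)
apply: (@le_trans _ _ (expR (`|w| * (1 - q ^+ n) / (1 - q)))); last first.
  by rewrite ler_expR ler_pM2r ?invr_gt0 // ler_piMr // gerBl ltW.
elim: n => [|n IHn]; first by rewrite qpoch0 normr1 expr0 subrr mulr0 mul0r expR0.
rewrite qpochS normrM.
rewrite (_ : _ * _ / _ = `|w| * (1 - q ^+ n) / (1 - q) + `|w| * q ^+ n); last first.
  by rewrite exprS; field; rewrite gt_eqF.
rewrite expRD ler_pM //; apply: le_trans (expR_ge1Dx _).
apply: le_trans (ler_normB _ _) _.
by rewrite normr1 normrM (gtr0_norm (qn0 n)).
Qed.

Lemma qpoch_majorant_le w w' : `|w| <= `|w'| -> qpoch_majorant w <= qpoch_majorant w'.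
Proof. by move=> ww'; rewrite ler_expR ler_pM2r ?invr_gt0. Qed.

Lemma qpoch_majorant_gt0 w : 0 < qpoch_majorant w.
Proof. exact: expR_gt0. Qed.

Lemma qpoch_cauchy w m n :
  `|qpoch w q (m + n) - qpoch w q m| <= q ^+ m * (`|w| * qpoch_majorant w / (1 - q)).
Proof.
apply: (@le_trans _ _ (q ^+ m * (`|w| * qpoch_majorant w * (1 - q ^+ n) / (1 - q)))); last first.
  rewrite ler_pM2l // ler_pM2r ?invr_gt0 // ler_piMr ?gerBl ?(ltW (qn0 n)) //.
  by rewrite mulr_ge0 // ltW ?qpoch_majorant_gt0.
elim: n => [|n IHn].
  by rewrite addn0 subrr normr0 expr0 subrr mulr0 mul0r mulr0.
rewrite addnS qpochS.
rewrite (_ : _ - _ = (qpoch w q (m + n) - qpoch w q m) - qpoch w q (m + n) * (w * q ^+ (m + n))); last by ring.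
apply: le_trans (ler_normB _ _) _.
rewrite [leRHS](_ : _ = q ^+ m * (`|w| * qpoch_majorant w * (1 - q ^+ n) / (1 - q)) +
   qpoch_majorant w * (`|w| * q ^+ (m + n))); last first.
  by rewrite exprS exprD; field; rewrite gt_eqF.
apply: lerD => //; rewrite !normrM (gtr0_norm (qn0 _)) ler_wpM2r ?qpoch_norm_le //.
by rewrite mulr_ge0 // ltW.
Qed.

Lemma qpoch_cvg w : qpoch w q @ \oo --> qpoch_inf w q.
Proof.
pose u n := qpoch w q n.+1 - qpoch w q n.
suff cu : cvgn (series u).
  rewrite /qpoch_inf -/(cvgn (qpoch w q)).
  rewrite (_ : qpoch w q = (fun n => series u n + 1)).
    by apply: is_cvgD => //; exact: is_cvg_cst.
  by apply/funext => n; rewrite seriesEnat /= telescope_sumr // qpoch0 subrK.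
apply: normed_cvg; apply: (@series_le_cvg _ _ (geometric (`|w| * qpoch_majorant w) q)) => //=.
- by move=> n; rewrite !mulr_ge0 // ltW ?qpoch_majorant_gt0.
- move=> n; rewrite /u qpochS (_ : _ - _ = - (qpoch w q n * (w * q ^+ n))); last by ring.
  rewrite normrN !normrM (gtr0_norm (qn0 n)) [leRHS](_ : _ = qpoch_majorant w * (`|w| * q ^+ n)); last by ring.
  by rewrite ler_wpM2r ?qpoch_norm_le // mulr_ge0 // ltW.
- by apply: is_cvg_geometric_series; rewrite gtr0_norm // -subr_gt0.
Qed.

Lemma qpoch_infP w l : qpoch w q @ \oo --> l -> qpoch_inf w q = l.
Proof. by move=> /cvg_lim; exact. Qed.

Lemma qpoch_inf_dist w m :
  `|qpoch_inf w q - qpoch w q m| <= q ^+ m * (`|w| * qpoch_majorant w / (1 - q)).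
Proof.
have c : (fun n => `|qpoch w q n - qpoch w q m|) @ \oo --> `|qpoch_inf w q - qpoch w q m|.
  by apply: cvg_norm; apply: cvgB; [exact: qpoch_cvg|exact: cvg_cst].
rewrite -(cvg_lim _ c) //; apply: limr_le; first by apply/cvg_ex; eexists; exact: c.
by exists m => // n /= mn; rewrite -(subnKC mn); exact: qpoch_cauchy.
Qed.

Lemma qpoch_inf_norm_le w : `|qpoch_inf w q| <= qpoch_majorant w.
Proof.
have c : (fun n => `|qpoch w q n|) @ \oo --> `|qpoch_inf w q|.
  by apply: cvg_norm; exact: qpoch_cvg.
rewrite -(cvg_lim _ c) //; apply: limr_le; first by apply/cvg_ex; eexists; exact: c.
by near=> n; exact: qpoch_norm_le.
Unshelve. all: by end_near. Qed.

Lemma qpoch_inf_split w k :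
  qpoch_inf w q = qpoch w q k * qpoch_inf (w * q ^+ k) q.
Proof.
apply: qpoch_infP; rewrite -(cvg_shiftn k) /=.
under eq_fun do rewrite addnC qpochD.
by apply: cvgMr; exact: qpoch_cvg.
Qed.

(** For large [k] the tail product [(w q^k;q)_oo] is at distance less than 1 from the empty product
    1, hence positive; the finitely many factors before it are positive. *)
Lemma qpoch_inf_gt0 w : w < 1 -> 0 < qpoch_inf w q.
Proof.
move=> w1; pose e := `|w| * qpoch_majorant w / (1 - q).
have e0 : (fun k => e * q ^+ k) @ \oo --> (0 : R).
  rewrite -[X in _ --> X](mulr0 e); apply: cvgMr; apply: cvg_expr.
  by rewrite gtr0_norm // -subr_gt0.
have [k _ Hk] := cvgr_lt _ e0 _ (@ltr01 R).
have {Hk}/= ek := Hk k (leqnn k).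
rewrite (qpoch_inf_split w k) mulr_gt0 ?qpoch_gt0 //.
have := qpoch_inf_dist (w * q ^+ k) 0.
rewrite qpoch0 expr0 mul1r => D.
have wk : `|w * q ^+ k| <= `|w|.
  by rewrite normrM (gtr0_norm (qn0 k)) ler_piMr.
have {}D : `|qpoch_inf (w * q ^+ k) q - 1| < 1.
  apply: le_lt_trans D (le_lt_trans _ ek).
  rewrite /e normrM (gtr0_norm (qn0 k)).
  rewrite [leRHS](_ : _ = `|w| * q ^+ k * qpoch_majorant w / (1 - q)); last by ring.
  rewrite ler_pM2r ?invr_gt0 // ler_wpM2l ?qpoch_majorant_le //.
  by rewrite mulr_ge0 // ltW.
by move: D; rewrite ltr_norml => /andP[+ _]; lra.
Qed.

Lemma qpoch_inf_le w w' : w < 1 -> w' <= w -> qpoch_inf w q <= qpoch_inf w' q.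
Proof.
move=> w1 w'w; apply: ler_cvg_to (@qpoch_cvg w) (@qpoch_cvg w') _.
near=> n; elim: {+}n => [|m IHm]; first by rewrite !qpoch0.
rewrite !qpochS; apply: ler_pM => //.
- by apply: ltW; exact: qpoch_gt0.
- have := qpoch_gt0 hq m.+1 w1; rewrite qpochS pmulr_rgt0 ?qpoch_gt0 //.
  exact: ltW.
- by rewrite lerD2l lerN2 ler_pM2r.
Unshelve. all: by end_near. Qed.

(** A limit does not preserve strictness, so the first factor is split off: it is compared strictly,
    the rest weakly. *)
Lemma qpoch_inf_lt w w' : w < 1 -> w' < w -> qpoch_inf w q < qpoch_inf w' q.
Proof.
move=> w1 w'w; rewrite (qpoch_inf_split w 1) (qpoch_inf_split w' 1) !qpochS !qpoch0.
rewrite !mul1r expr0 !mulr1 expr1.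
have wq1 : w * q < 1.
  have [w0|w0] := ltP 0 w; last by apply: le_lt_trans ltr01; rewrite mulr_le0_ge0 // ltW.
  by apply: le_lt_trans w1; rewrite ler_piMr ?ltW // -subr_gt0.
apply: (@lt_le_trans _ _ ((1 - w') * qpoch_inf (w * q) q)).
  by rewrite ltr_pM2r ?qpoch_inf_gt0 //; lra.
rewrite ler_pM2l ?subr_gt0; last exact: lt_trans w1.
by apply: qpoch_inf_le; rewrite // ler_pM2r // ltW.
Qed.

(** The inverse equals [(w q^n;q)_oo / (w;q)_oo], whose numerator is below the majorant of [w]. *)
Lemma qpoch_inv_bounded w : w < 1 ->
  exists2 D, 0 <= D & forall n, (qpoch w q n)^-1 <= D.
Proof.
move=> w1; exists (qpoch_majorant w / qpoch_inf w q) => [|n].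
  by rewrite divr_ge0 ?ltW ?qpoch_majorant_gt0 ?qpoch_inf_gt0.
rewrite ler_pdivlMr ?qpoch_inf_gt0 // (qpoch_inf_split w n).
rewrite mulKf ?qpoch_neq0 //; apply: le_trans (ler_norm _) _.
apply: le_trans (qpoch_inf_norm_le _) _; apply: qpoch_majorant_le.
by rewrite normrM (gtr0_norm (qn0 n)) ler_piMr.
Qed.

Lemma sum_1phi1 (a u : R) :
  series (fun k => qpoch a q k / qpoch q q k * u ^+ k * q ^+ 'C(k, 2) *
    qpoch_inf (- (a * u * q ^+ k)) q) @ \oo --> qpoch_inf (- u) q.
Proof.
(* Tannery's argument: [s n k] are the terms of [sum_1phi1_fin], within [O(q^n q^-k)] of their limits. *)
pose t k := qpoch a q k / qpoch q q k * u ^+ k * q ^+ 'C(k, 2).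
pose s n k := qpoch q q n / qpoch q q (n - k) * qpoch (- (a * u * q ^+ k)) q (n - k).
pose D := qpoch_majorant (a * u).
(* The first summand bounds the error of the ratio of [(q;q)] symbols, the second that of truncating
   the infinite product. *)
pose E := qpoch_majorant 1 / (1 - q) * D + `|a * u| * D / (1 - q).
have D0 : 0 < D by exact: qpoch_majorant_gt0.
have auk k : `|- (a * u * q ^+ k)| <= `|a * u|.
  by rewrite normrN normrM (gtr0_norm (qn0 k)) ler_piMr.
have E0 : 0 <= E.
  have [m0 D0'] := (ltW (qpoch_majorant_gt0 1), ltW D0).
  by rewrite addr_ge0 // ?mulr_ge0 ?invr_ge0 // ltW.
have sE n k : (k <= n)%N ->
    `|s n k - qpoch_inf (- (a * u * q ^+ k)) q| <= E * q ^+ n * (q ^+ k)^-1.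
  move=> kn; rewrite /s -[in qpoch q q n](subnK kn) qpochD -exprS.
  rewrite (mulrC (qpoch q q _) (qpoch _ q k)) mulfK ?qq_neq0 //.
  set p := qpoch (- _) q _; set e := qpoch _ q k; set G := qpoch_inf _ q.
  rewrite (_ : _ - _ = (e - 1) * p - (G - p)); last by ring.
  apply: le_trans (ler_normB _ _) _.
  have qnk : q ^+ n * (q ^+ k)^-1 = q ^+ (n - k).
    by rewrite -{1}(subnK kn) exprD mulfK // gt_eqF.
  rewrite [leRHS](_ : _ = E * q ^+ (n - k)); last by rewrite -mulrA qnk.
  rewrite /E [leRHS]mulrDl; apply: lerD.
    rewrite normrM mulrAC; apply: ler_pM => //; last first.
      by apply: le_trans (qpoch_norm_le _ _) (qpoch_majorant_le (auk k)).
    have := qpoch_cauchy (q ^+ (n - k).+1) 0 k.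
    rewrite qpoch0 add0n expr0 mul1r => /le_trans; apply.
    rewrite (gtr0_norm (qn0 _)) -mulrA [leRHS]mulrC.
    apply: ler_pM.
    - exact: ltW.
    - by rewrite ltW // divr_gt0 // qpoch_majorant_gt0.
    - by rewrite exprS ler_piMl ?(ltW (qn0 _)) // -(expr1 q).
    - rewrite ler_pM2r ?invr_gt0 // qpoch_majorant_le //.
      by rewrite normr1 (gtr0_norm (qn0 _)).
  apply: le_trans (qpoch_inf_dist _ _) _.
  rewrite [leRHS]mulrC ler_pM2l // ler_pM2r ?invr_gt0 //.
  by apply: ler_pM => //; [exact: ltW (qpoch_majorant_gt0 _)|exact: qpoch_majorant_le].
have [D' D'0 HD'] := qpoch_inv_bounded ql1.
(* Dividing [|u|] by [q] absorbs the loss [q^-k] in the error estimate [sE]. *)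
pose g := gauss q (`|u| / q).
have g0 k : 0 <= g k by apply: gauss_ge0; [exact: ltW|rewrite divr_ge0 // ltW].
have ndg : nondecreasing_seq (series g).
  by apply/nondecreasing_seqP => n; rewrite seriesSr lerDl.
have cg : cvgn (series g) by apply: gauss_summable => //; rewrite divr_ge0 // ltW.
have tg k : `|t k| * (q ^+ k)^-1 <= qpoch_majorant a * D' * g k.
  rewrite /t !normrM !normfV !normrX (gtr0_norm q0) (gtr0_norm (qpoch_gt0 hq k ql1)).
  rewrite /g /gauss expr_div_n.
  rewrite (_ : _ * _ = `|qpoch a q k| / qpoch q q k * (`|u| ^+ k / q ^+ k * q ^+ 'C(k, 2))); last by ring.
  apply: ler_wpM2r; first by rewrite !mulr_ge0 ?invr_ge0 ?exprn_ge0 // ltW.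
  apply: ler_pM => //; last exact: qpoch_norm_le.
  by rewrite invr_ge0 ltW // qpoch_gt0.
(* The partial sum at [n.+1] runs over [k <= n], as does the finite identity for [n]. *)
rewrite -cvg_shiftS /=.
apply: (@cvg_dist_le _ _ (fun n => (E * (qpoch_majorant a * D' * limn (series g))) * q ^+ n +
    `|qpoch (- u) q n - qpoch_inf (- u) q|)); last first.
  rewrite -[X in _ --> X](addr0 0); apply: cvgD.
    rewrite -[X in _ --> X](mulr0 (E * (qpoch_majorant a * D' * limn (series g)))).
    by apply: cvgMr; apply: cvg_expr; rewrite gtr0_norm // -subr_gt0.
  rewrite -[X in _ --> X](normr0 R); apply: cvg_norm.
  by rewrite -[X in _ --> X](subrr (qpoch_inf (- u) q)); apply: cvgB; [exact: qpoch_cvg|exact: cvg_cst].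
move=> n /=; rewrite seriesEnat /= big_mkord.
set A := \sum_(_ < _) _; set L := qpoch_inf (- u) q.
rewrite (_ : A - L = (A - qpoch (- u) q n) + (qpoch (- u) q n - L)); last by ring.
apply: (le_trans (ler_normD _ _)); rewrite lerD2r.
rewrite -(sum_1phi1_fin hq a u n) -sumrB.
apply: le_trans (ler_norm_sum _ _ _) _.
apply: (@le_trans _ _ (\sum_(k < n.+1) E * q ^+ n * (qpoch_majorant a * D') * g k)); last first.
  rewrite -mulr_sumr -(big_mkord xpredT g) -[\sum_(0 <= _ < _) _]/(series g n.+1).
  rewrite [leRHS](_ : _ = E * q ^+ n * (qpoch_majorant a * D') * limn (series g)); last by ring.
  apply: ler_wpM2l; last exact: nondecreasing_cvgn_le.
  have := ltW (qpoch_majorant_gt0 a) => m0; rewrite !mulr_ge0 //; exact: ltW.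
apply: ler_sum => -[k /= kn] _; rewrite ltnS in kn.
rewrite /qbin kn.
rewrite (_ : _ - _ = - (t k * (s n k - qpoch_inf (- (a * u * q ^+ k)) q))); last first.
  by rewrite /t /s; field; rewrite !qq_neq0.
rewrite normrN normrM; apply: (@le_trans _ _ (`|t k| * (E * q ^+ n * (q ^+ k)^-1))).
  by apply: ler_wpM2l => //; exact: sE.
rewrite [leLHS](_ : _ = E * q ^+ n * (`|t k| * (q ^+ k)^-1)); last by ring.
rewrite -[leRHS]mulrA; apply: ler_wpM2l => //.
by rewrite mulr_ge0 // ltW.
Qed.

End QPochInf.

(** * Moments and bounds for the two factors of the kernel *)

Section PiPrime.
Variables (R : realType) (q : R).
Hypothesis hq : 0 < q < 1.

Lemma bin2D x k : 'C(x + k, 2) = ('C(x, 2) + x * k + 'C(k, 2))%N.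
Proof.
elim: k => [|k IHk]; first by rewrite bin0n muln0 !addn0.
by rewrite addnS !bin2S IHk mulnS; ring.
Qed.

Lemma qexpz_sub m n : q ^ (m%:Z - n%:Z) = q ^+ m / q ^+ n.
Proof. by rewrite expfzDr ?q_neq0 // exprnP -exprnN. Qed.

(** Since [b + q^(i+1-z) = q^(i+1-z) (1 + b q^(z-i-1))], the finite product prolongs the infinite
    one downwards from [b q^z] to [b q^(z-j)]. *)
Lemma wprod_qpoch_inf (b : R) z j :
  wprod q b (- (q * q ^- z)) j * qpoch_inf (- (b * q ^+ z)) q =
  q ^+ 'C(j.+1, 2) * (q ^- z) ^+ j * qpoch_inf (- (b * q ^+ z / q ^+ j)) q.
Proof.
elim: j => [|j IHj].
  by rewrite /wprod big_nil !expr0 divr1 !mul1r.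
rewrite wprodS mulrAC IHj [in RHS](qpoch_inf_split hq _ 1) qpochS qpoch0 expr0 expr1.
have -> : - (b * q ^+ z / q ^+ j.+1) * q = - (b * q ^+ z / q ^+ j).
  by rewrite exprS; field; rewrite qexp_neq0 // q_neq0.
rewrite [in RHS]bin2S exprD [(q ^- z) ^+ j.+1]exprS.
move: (qpoch_inf _ _) => G; rewrite [q ^+ j.+1]exprS; field.
by rewrite !qexp_neq0 // q_neq0.
Qed.

(* [wprod q b (- (q * q ^- z)) j] is the product of [b + q^(i+1-z)] over [i < j]; on this basis
   [pi_prime] just replaces [b] by [b / a]. *)
Lemma sum_pi_prime_wprod (a b : R) x j : a != 0 ->
  (forall m, qpoch (- b) q m != 0) -> qpoch_inf (- (a^-1 * b)) q != 0 ->
  series (fun k => pi_prime q a b (x + k) x * wprod q b (- (q * q ^- (x + k))) j)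
    @ \oo --> wprod q (a^-1 * b) (- (q * q ^- x)) j.
Proof.
move=> a0 b0 G0; set B := a^-1 * b in G0 *.
(* Chosen so that [a * u * q ^+ k] is [b * q ^+ (x + k) / q ^+ j], the argument produced by
   [wprod_qpoch_inf]; the powers of [u] collect everything geometric in [k]. *)
pose u := B * q ^+ x / q ^+ j.
pose cst := qpoch (- B) q x / qpoch_inf (- B) q * (q ^+ 'C(j.+1, 2) * (q ^- x) ^+ j).
have Gx0 : qpoch_inf (- (B * q ^+ x)) q != 0.
  by move: G0; rewrite (qpoch_inf_split hq _ x) mulf_eq0 negb_or mulNr => /andP[].
have Bx0 : qpoch (- B) q x != 0.
  by move: G0; rewrite (qpoch_inf_split hq _ x) mulf_eq0 negb_or => /andP[].
rewrite (_ : wprod q B _ j = cst * qpoch_inf (- u) q); last first.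
  apply: (mulIf Gx0); rewrite wprod_qpoch_inf /cst (qpoch_inf_split hq (- B) x) mulNr.
  by rewrite /u; field; rewrite ?Gx0 ?Bx0 ?(qexp_neq0 hq).
rewrite (_ : series _ = (fun N => cst * series (fun k => qpoch a q k / qpoch q q k * u ^+ k * q ^+ 'C(k, 2) *
    qpoch_inf (- (a * u * q ^+ k)) q) N)); last first.
  apply/funext => N; rewrite !seriesEnat /= mulr_sumr; apply: eq_bigr => k _.
  have bxk : qpoch_inf (- b) q = qpoch (- b) q (x + k) * qpoch_inf (- (b * q ^+ (x + k))) q.
    by rewrite (qpoch_inf_split hq _ (x + k)) mulNr.
  rewrite /pi_prime addKn qexpz_sub bin2D bxk -/B.
  set V := qpoch_inf (- (b * _)) q; set W := wprod _ _ _ _.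
  rewrite (_ : _ * W = qpoch (- B) q x * qpoch a q k * B ^+ k *
    (q ^+ ('C(x, 2) + x * k + 'C(k, 2)) / q ^+ 'C(x, 2)) / (qpoch q q k * qpoch_inf (- B) q) * (W * V)); last first.
    by field; rewrite ?G0 ?b0 ?(qq_neq0 hq) ?(qexp_neq0 hq).
  rewrite wprod_qpoch_inf.
  have -> : a * u * q ^+ k = b * q ^+ (x + k) / q ^+ j.
    by rewrite /u /B exprD; field; rewrite a0 qexp_neq0.
  rewrite /cst; move: (qpoch_inf (- (b * _ / _)) q) (q ^+ 'C(j.+1, 2)) => T S.
  have -> : u ^+ k = B ^+ k * q ^+ (x * k) / (q ^+ j) ^+ k.
    by rewrite /u expr_div_n exprMn exprM.
  have -> : (q ^- (x + k)) ^+ j = (q ^- x) ^+ j / (q ^+ j) ^+ k.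
    by rewrite exprD invfM exprMn [_^-1 ^+ j in X in _ * X]exprVn -!exprM mulnC.
  rewrite !exprD; move: (_ ^+ j) (qexp_neq0 hq j) => X qj; field.
  by rewrite ?G0 ?(qq_neq0 hq) ?(qexp_neq0 hq) ?expf_neq0.
by apply: cvgMr; exact: sum_1phi1.
Qed.

Lemma sum_pi_prime_P_qM (a b c : R) n x : a != 0 -> b != 0 -> c != 0 ->
  (forall m, qpoch (- b) q m != 0) -> qpoch_inf (- (a^-1 * b)) q != 0 ->
  (forall m, qpoch c q m != 0) -> (forall m, qpoch (a * c) q m != 0) ->
  series (fun k => pi_prime q a b (x + k) x *
      P_qM q n (x + k) (a * c * q^-1) ((a * c)^-1 * b)) @ \oo -->
    qpoch c q n / qpoch (a * c) q n * P_qM q n x (c * q^-1) ((a * c)^-1 * b).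
Proof.
move=> a0 b0 c0 hb G0 hc hac; set g := (a * c)^-1 * b.
have g0 : g != 0 by rewrite mulf_neq0 ?invr_eq0 ?mulf_neq0.
(* The coefficients [d] see the parameters only through [s], and [s * b = a * c] while
   [s * (a^-1 * b) = c]: both q-Meixner functions share one expansion. *)
pose W := - (q / g); pose s := a * c / b.
pose d k := qbin q n k * ((-1) ^+ k * q ^+ 'C(k, 2) * s ^+ k * qpoch (W * q ^+ k) q (n - k)).
have PE C' b' z : s * b' = C' -> (forall m, qpoch C' q m != 0) ->
    qpoch C' q n * P_qM q n z (C' * q^-1) g = \sum_(k < n.+1) d k * wprod q b' (- (q * q ^- z)) k.
  move=> sb hC; rewrite P_qM_heine // heine_sym //; apply: eq_bigr => k _.
  rewrite /d /heine_term -/W -sb (_ : q ^- z * W = s * - (q * q ^- z)); last first.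
    by rewrite /W /s /g; field; rewrite a0 b0 c0 qexp_neq0.
  by rewrite wprod_scale; ring.
rewrite [X in _ --> X](_ : _ = (qpoch (a * c) q n)^-1 *
  (qpoch c q n * P_qM q n x (c * q^-1) g)); last by rewrite mulrAC mulrC.
rewrite (PE _ (a^-1 * b)) //; last first.
  by rewrite /s; field; rewrite a0 b0.
rewrite (_ : series _ = (fun N => (qpoch (a * c) q n)^-1 * series (fun k => \sum_(j < n.+1) d j *
    (pi_prime q a b (x + k) x * wprod q b (- (q * q ^- (x + k))) j)) N)); last first.
  apply/funext => N; rewrite !seriesEnat /= mulr_sumr; apply: eq_bigr => k _.
  rewrite -[P_qM _ _ _ _ _](mulKf (hac n)) (PE _ b) //; last by rewrite /s divfK.
  by rewrite mulrCA mulr_sumr; congr (_ * _); apply: eq_bigr => j _; ring.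
apply: cvgMr; apply: (@cvg_series_linear _ _ d
  (fun k j => pi_prime q a b (x + k) x * wprod q b (- (q * q ^- (x + k))) j)
  (fun j => wprod q (a^-1 * b) (- (q * q ^- x)) j)).
by move=> j; exact: sum_pi_prime_wprod.
Qed.

(** The factors [1 - q^(i-x)] are at most [2 q^-x] in absolute value, and at most [n] of them occur.
    This geometric growth in [x] is absorbed by the parameter of [gauss]. *)
Lemma P_qM_bounded n (C g : R) :
  exists2 D, 0 <= D & forall x, `|P_qM q n x C g| <= D * (q ^- n) ^+ x.
Proof.
have [q0 q1] := andP hq.
pose e k := qpoch (q ^- n) q k / (qpoch (C * q) q k * qpoch q q k) *
    (- (g^-1 * q ^+ n.+1)) ^+ k.
exists (\sum_(k < n.+1) `|e k| * 2 ^+ k) => [|x].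
  by apply: sumr_ge0 => k _; rewrite mulr_ge0 ?exprn_ge0.
rewrite /P_qM big_mkord; apply: le_trans (ler_norm_sum _ _ _) _.
rewrite mulr_suml; apply: ler_sum => -[k /= kn] _; rewrite ltnS in kn.
rewrite (_ : _ * _ / _ * _ = e k * qpoch (q ^- x) q k); last by rewrite /e; ring.
rewrite normrM -[leRHS]mulrA ler_wpM2l //.
have qV1 m : 1 <= q ^- m by rewrite invf_ge1 ?exprn_gt0 // exprn_ile1 // ltW.
apply: (@le_trans _ _ ((2 * q ^- x) ^+ k)).
  elim: k {kn} => [|k IHk]; first by rewrite qpoch0 normr1 expr0.
  rewrite qpochS normrM exprSr ler_pM //.
  apply: le_trans (ler_normB _ _) _; rewrite normr1.
  have x0 : 0 < q ^- x by rewrite invr_gt0 exprn_gt0.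
  rewrite ger0_norm; last by rewrite mulr_ge0 ?exprn_ge0 ?ltW.
  have : q ^- x * q ^+ k <= q ^- x by rewrite ler_piMr ?exprn_ile1 ?ltW.
  by have := qV1 x; lra.
rewrite exprMn ler_wpM2l ?exprn_ge0 // exprVn -exprM exprVn -exprM.
rewrite lef_pV2 ?posrE ?exprn_gt0 //.
rewrite (mulnC x) ler_wiXn2l ?ltW // leq_mul2r kn orbT //.
Qed.

Lemma pi_qH_bounded (a c : R) : `|c| <= 1 -> a * c < 1 ->
  exists2 D, 0 <= D & forall x z, `|pi_qH q x z c a| <= D.
Proof.
move=> c1 ac1; have [q0 q1] := andP hq.
have [Dq Dq0 HDq] := qpoch_inv_bounded hq q1.
have [D D0 HD] := qpoch_inv_bounded hq ac1.
have M0 w : 0 <= qpoch_majorant q w by rewrite ltW // qpoch_majorant_gt0.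
exists (qpoch_majorant q q * (Dq * Dq) *
   (qpoch_majorant q c * qpoch_majorant q a * D)) => [|x z]; first by rewrite !mulr_ge0.
rewrite /pi_qH (mulrC c a) invfM !normrM !normfV.
rewrite !(gtr0_norm (qpoch_gt0 hq _ q1)) (gtr0_norm (qpoch_gt0 hq _ ac1)).
have qz : qpoch q q z <= qpoch_majorant q q.
  by apply: le_trans (qpoch_norm_le hq _ _); exact: ler_norm.
have qi0 m : 0 <= (qpoch q q m)^-1 by rewrite invr_ge0 ltW // qpoch_gt0.
have c1' : `|c ^+ (z - x)| <= 1 by rewrite normrX exprn_ile1.
have ac0 : 0 <= (qpoch (a * c) q z)^-1 by rewrite invr_ge0 ltW // qpoch_gt0.
apply: ler_pM.
- by rewrite !mulr_ge0 // ltW // qpoch_gt0.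
- by rewrite !mulr_ge0.
- apply: ler_pM => //; [by rewrite ltW // qpoch_gt0|by rewrite mulr_ge0|].
  by apply: ler_pM.
- apply: ler_pM => //.
  rewrite -[leRHS]mulr1; apply: ler_pM => //.
  by apply: ler_pM => //; exact: qpoch_norm_le.
Qed.

(** The weight [q ^+ 'C(y, 2)] cancels the negative power of [q] in [pi_prime]. It is a constant
    when [y] is fixed, and [v] supplies it when [y] is summed. *)
Lemma pi_prime_bounded (a b : R) : - b < 1 ->
  exists2 D, 0 <= D & forall y z, (y <= z)%N ->
    `|pi_prime q a b z y| * q ^+ 'C(y, 2) <= D * gauss q (1 + `|a^-1 * b|) z.
Proof.
move=> b1; have [q0 q1] := andP hq; rewrite /pi_prime.
move: (a^-1 * b) => B.
have [Dq Dq0 HDq] := qpoch_inv_bounded hq q1.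
have [D D0 HD] := qpoch_inv_bounded hq b1.
have M0 w : 0 <= qpoch_majorant q w by rewrite ltW // qpoch_majorant_gt0.
have qi0 m : 0 <= (qpoch q q m)^-1 by rewrite invr_ge0 ltW // qpoch_gt0.
have b0 m : 0 <= (qpoch (- b) q m)^-1 by rewrite invr_ge0 ltW // qpoch_gt0.
move: (qpoch_inf (- b) q / qpoch_inf (- B) q) => G.
exists (qpoch_majorant q (- B) * qpoch_majorant q a * (D * Dq) * `|G|) => [|y z yz].
  by rewrite !mulr_ge0.
rewrite qexpz_sub invfM !normrM.
rewrite (ger0_norm (b0 _)) (ger0_norm (qi0 _)).
rewrite (gtr0_norm (_ : 0 < q ^+ 'C(z, 2))) ?exprn_gt0 //.
rewrite (gtr0_norm (_ : 0 < (q ^+ 'C(y, 2))^-1)) ?invr_gt0 ?exprn_gt0 //.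
rewrite [leLHS](_ : _ = (`|qpoch (- B) q y| * `|qpoch a q (z - y)| *
   ((qpoch (- b) q z)^-1 * (qpoch q q (z - y))^-1) * `|G|) * (`|B ^+ (z - y)| * q ^+ 'C(z, 2))); last first.
  by field; rewrite qq_neq0 // qpoch_neq0 // qexp_neq0.
have BB : `|B ^+ (z - y)| <= (1 + `|B|) ^+ z.
  rewrite normrX; apply: (@le_trans _ _ ((1 + `|B|) ^+ (z - y))).
    by apply: lerXn2r; rewrite ?nnegrE ?addr_ge0 // lerDr.
  by rewrite ler_weXn2l ?leq_subr // lerDl.
apply: ler_pM; rewrite ?mulr_ge0 ?exprn_ge0 ?(ltW q0) //.
  apply: ler_wpM2r => //; apply: ler_pM; rewrite ?mulr_ge0 //.
    by apply: ler_pM => //; exact: qpoch_norm_le.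
  exact: ler_pM.
by rewrite /gauss ler_wpM2r // exprn_ge0 // ltW.
Qed.

End PiPrime.

(** * The kernel and its eigenvectors *)

Section Kernel.
Variables (R : realType) (q a b c : R).
Hypotheses (hq : 0 < q < 1) (ha : 0 < a < 1) (hb : 0 < b) (hc : 0 < c < 1).

Let q0 : 0 < q. Proof. by case/andP: hq. Qed.
Let q1 : q < 1. Proof. by case/andP: hq. Qed.
Let a0 : 0 < a. Proof. by case/andP: ha. Qed.
Let a1 : a < 1. Proof. by case/andP: ha. Qed.
Let c0 : 0 < c. Proof. by case/andP: hc. Qed.
Let c1 : c < 1. Proof. by case/andP: hc. Qed.
Let B := a^-1 * b.
Let B0 : 0 < B. Proof. by rewrite mulr_gt0 ?invr_gt0. Qed.
Let NB1 : - B < 1. Proof. by rewrite ltrNl (lt_trans _ B0) // ltrN10. Qed.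
Let Nb1 : - b < 1. Proof. by rewrite ltrNl (lt_trans _ hb) // ltrN10. Qed.
Let ac1 : a * c < 1. Proof. by apply: lt_trans a1; rewrite gtr_pMr. Qed.
Let ac0 : 0 < a * c. Proof. by rewrite mulr_gt0. Qed.

(** Extension by zero makes [K] a series starting at 0 and gives the triangular shape required by
    [triangular_fubini]. *)
Definition Kterm0 x y z := if (x <= z)%N && (y <= z)%N then Kterm q a b c x y z else 0.

Lemma Kterm0_seriesE x y :
  (fun m => \sum_(maxn x y <= z < m) Kterm q a b c x y z) = series (Kterm0 x y).
Proof.
apply/funext => m; rewrite seriesEnat /= (@big_nat_widenl _ _ _ _ 0) // big_mkcond /=.
by apply: eq_bigr => z _; rewrite /Kterm0 geq_max.
Qed.

Let P n x := P_qM q n x (c * q^-1) ((a * c)^-1 * b).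

Lemma P_qM0 x C g : P_qM q 0 x C g = 1.
Proof. by rewrite /P_qM big_nat1 !qpoch0 expr0 !(mulr1, invr1). Qed.

(** For fixed [z] the q-Hahn sum over [x] comes first, then [pi_prime] is summed over [z]. The sum
    is over the first argument of [K], so [P n] is an eigenfunction of the transpose; the case
    [n = 0] also yields the convergence of [K]. *)
Lemma sum_Kterm0_P n y :
  (forall x, cvgn (series (fun z => Kterm0 x y z * P n x))) /\
  series (fun x => limn (series (fun z => Kterm0 x y z * P n x))) @ \oo -->
    kappa q a c n * P n y.
Proof.
have [Dh Dh0 HDh] : exists2 D, 0 <= D & forall x z, `|pi_qH q x z c a| <= D.
  by apply: pi_qH_bounded => //; rewrite gtr0_norm // ltW.
have [Dp Dp0 HDp] := pi_prime_bounded hq a Nb1.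
have [DP DP0 HDP] := P_qM_bounded hq n (c * q^-1) ((a * c)^-1 * b).
have qn1 : 1 <= q ^- n by rewrite invf_ge1 ?exprn_gt0 // exprn_ile1 // ltW.
have C0 : 0 <= Dh * (Dp / q ^+ 'C(y, 2)) * DP.
  by rewrite !mulr_ge0 // invr_ge0 exprn_ge0 // ltW.
have M0 : 0 <= (1 + `|a^-1 * b|) * q ^- n.
  by rewrite mulr_ge0 ?addr_ge0 // (le_trans ler01).
apply: (@triangular_fubini _ q (Dh * (Dp / q ^+ 'C(y, 2)) * DP) ((1 + `|a^-1 * b|) * q ^- n)
  (fun z x => Kterm0 x y z * P n x)) => //.
- by move=> z x zx; rewrite /Kterm0 leqNgt zx mul0r.
- move=> z x xz.
  have [yz|zy] := leqP y z; last first.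
    rewrite /Kterm0 [(y <= z)%N]leqNgt zy andbF mul0r normr0.
    by rewrite mulr_ge0 // gauss_ge0 // ltW.
  rewrite /Kterm0 xz yz /= /Kterm 2!normrM.
  rewrite [leRHS](_ : _ = Dh * (Dp * gauss q (1 + `|a^-1 * b|) z / q ^+ 'C(y, 2)) * (DP * (q ^- n) ^+ z)); last first.
    by rewrite gaussM; move: (_ ^+ z) => qz; ring.
  apply: ler_pM => //.
    apply: ler_pM => //.
    by rewrite ler_pdivlMr ?exprn_gt0 // HDp.
  apply: le_trans (HDP x) _; apply: ler_wpM2l => //.
  by rewrite ler_weXn2l.
- apply: (@cvg_series_shift _ _ y) => [z zy|].
    apply: big1 => x _; by rewrite /Kterm0 [(y <= z)%N]leqNgt zy andbF mul0r.
  rewrite (_ : (fun k => _) = (fun k => pi_prime q a b (y + k) y *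
      P_qM q n (y + k) (a * c * q^-1) ((a * c)^-1 * b))); last first.
    apply/funext => k; rewrite -(@pi_qH_P_qM _ _ hq); last 2 first.
    - by move=> m; exact: qpoch_neq0.
    - by move=> m; exact: qpoch_neq0.
    rewrite mulr_sumr; apply: eq_bigr => -[x /= xz] _.
    by rewrite /Kterm0 -ltnS xz leq_addr /= /Kterm /P; ring.
  apply: sum_pi_prime_P_qM; rewrite ?gt_eqF // ?qpoch_inf_gt0 //.
  + by move=> m; exact: qpoch_neq0.
  + by move=> m; exact: qpoch_neq0.
  + by move=> m; exact: qpoch_neq0.
Qed.

Lemma K_cvg x y : series (Kterm0 x y) @ \oo --> K q a b c x y.
Proof.
rewrite /K Kterm0_seriesE.
have [cF _] := sum_Kterm0_P 0 y.
have := cF x; rewrite (_ : (fun z => _) = Kterm0 x y) //.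
by apply/funext => z; rewrite /P P_qM0 mulr1.
Qed.

Lemma K_scale_cvg x y w : series (fun z => Kterm0 x y z * w) @ \oo --> K q a b c x y * w.
Proof.
rewrite (_ : series _ = (fun N => series (Kterm0 x y) N * w)).
  by apply: cvgMl; exact: K_cvg.
by apply/funext => N; rewrite !seriesEnat /= mulr_suml.
Qed.

Lemma K_ge0 x y : 0 <= K q a b c x y.
Proof.
rewrite -(cvg_lim _ (@K_cvg x y)) //; apply: limr_ge.
  by apply/cvg_ex; eexists; exact: K_cvg.
near=> N; rewrite seriesEnat /=; apply: sumr_ge0 => z _; rewrite /Kterm0.
case: ifP => // /andP[xz yz]; rewrite /Kterm /pi_qH /pi_prime qexpz_sub // (mulrC c a).
have pq w m : w < 1 -> 0 <= qpoch w q m by move=> w1; rewrite ltW // qpoch_gt0.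
have pG w : w < 1 -> 0 <= qpoch_inf w q by move=> w1; rewrite ltW // qpoch_inf_gt0.
by rewrite !mulr_ge0 ?invr_ge0 ?mulr_ge0 ?pq ?pG ?exprn_ge0 // ltW.
Unshelve. all: by end_near. Qed.

Lemma sum_K_P n y :
  series (fun x => K q a b c x y * P n x) @ \oo --> kappa q a c n * P n y.
Proof.
have [_] := sum_Kterm0_P n y; rewrite (_ : (fun x => limn _) = (fun x => K q a b c x y * P n x)) //.
by apply/funext => x; apply: cvg_lim => //; exact: K_scale_cvg.
Qed.

Let pi x := pi_qM q x (c * q^-1) ((a * c)^-1 * b).

(** Detailed balance already holds for each [z]: [pi y] cancels the symbol [(-b/a;q)_y] of
    [pi_prime] and supplies the missing factors in [y], so the product is symmetric in [x] and
    [y]. *)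
Lemma K_sym x y : K q a b c x y * pi y = K q a b c y x * pi x.
Proof.
rewrite -(cvg_lim _ (@K_scale_cvg x y (pi y))) // -(cvg_lim _ (@K_scale_cvg y x (pi x))) //.
congr (limn (series _)); apply/funext => z; rewrite /Kterm0 andbC.
case: ifP => [/andP[yz xz]|_]; last by rewrite !mul0r.
rewrite /Kterm /pi_qH /pi_prime /pi /pi_qM !qexpz_sub // !divfK ?q_neq0 //.
rewrite (_ : c * q^-1 * ((a * c)^-1 * b) * q = B); last first.
  by rewrite /B; field; rewrite !gt_eqF.
rewrite (_ : (a * c)^-1 * b = c^-1 * B); last by rewrite /B; field; rewrite !gt_eqF.
rewrite -/B (mulrC c a) !(exprMn _ c^-1) !exprVn.
have cz w : (w <= z)%N -> c ^+ (z - w) = c ^+ z / c ^+ w.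
  by move=> wz; rewrite -{2}(subnK wz) exprD mulfK // expf_neq0 // gt_eqF.
have Bz w : (w <= z)%N -> B ^+ (z - w) = B ^+ z / B ^+ w.
  by move=> wz; rewrite -{2}(subnK wz) exprD mulfK // expf_neq0 // gt_eqF.
rewrite !cz // !Bz //.
have pq w m : w < 1 -> qpoch w q m != 0 by move=> w1; rewrite qpoch_neq0.
have g1 : - (c^-1 * B) < 1 by rewrite ltrNl (lt_trans (ltrN10 _)) // mulr_gt0 ?invr_gt0.
have Gg := gt_eqF (qpoch_inf_gt0 hq g1); have GB := gt_eqF (qpoch_inf_gt0 hq NB1).
have Bn m : B ^+ m != 0 by rewrite expf_neq0 // gt_eqF.
have cn m : c ^+ m != 0 by rewrite expf_neq0 // gt_eqF.
move: (B) (pq (- B) ^~ NB1) (qpoch_inf (- _) q) Gg GB Bn => B' pB Gb.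
move=> /negbT Gg /negbT GB Bn; field.
by rewrite !(qq_neq0 hq) !(qexp_neq0 hq) !cn !Bn !pB ?pq // Gg GB.
Qed.

(* Applying [pi_prime] to [v] is a q-Hahn sum with [c] replaced by [- b / a], after which the q-Hahn
   factor acts as [pi_prime] with [b] replaced by [- a c]. *)
Lemma sum_Kterm0_v n x :
  (forall y, cvgn (series (fun z => Kterm0 x y z * v q a b c n y))) /\
  series (fun y => limn (series (fun z => Kterm0 x y z * v q a b c n y))) @ \oo -->
    kappa_minus q a b c n * v q a b c n x.
Proof.
have [Dh Dh0 HDh] : exists2 D, 0 <= D & forall x z, `|pi_qH q x z c a| <= D.
  by apply: pi_qH_bounded => //; rewrite gtr0_norm // ltW.
have [Dp Dp0 HDp] := pi_prime_bounded hq a Nb1.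
have [Dq Dq0 HDq] := qpoch_inv_bounded hq q1.
have [DP DP0 HDP] := P_qM_bounded hq n (- (a^-1 * b * q^-1)) (a * c * b^-1).
have qn1 : 1 <= q ^- n by rewrite invf_ge1 ?exprn_gt0 // exprn_ile1 // ltW.
have C0 : 0 <= Dh * Dp * (Dq * DP) by rewrite !mulr_ge0.
have M0 : 0 <= (1 + `|a^-1 * b|) * q ^- n.
  by rewrite mulr_ge0 ?addr_ge0 // (le_trans ler01).
apply: (@triangular_fubini _ q (Dh * Dp * (Dq * DP)) ((1 + `|a^-1 * b|) * q ^- n)
  (fun z y => Kterm0 x y z * v q a b c n y)) => //.
- by move=> z y zy; rewrite /Kterm0 [(y <= z)%N]leqNgt zy andbF mul0r.
- move=> z y yz.
  have [xz|zx] := leqP x z; last first.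
    rewrite /Kterm0 [(x <= z)%N]leqNgt zx mul0r normr0.
    by rewrite mulr_ge0 // gauss_ge0 // ltW.
  rewrite /Kterm0 xz yz /= /Kterm /v.
  set PP := P_qM _ _ _ _ _.
  rewrite (_ : _ * _ = pi_qH q x z c a * (pi_prime q a b z y * q ^+ 'C(y, 2)) *
    ((-1) ^+ y * ((qpoch q q y)^-1 * PP))); last by ring.
  rewrite (normrM (_ * _) (_ * _)) (normrM (pi_qH _ _ _ _ _)) (normrM (pi_prime _ _ _ _ _)).
  rewrite (normrM ((-1) ^+ y)) (normrM (qpoch q q y)^-1) (normrX _ (-1)) normrN1 expr1n mul1r.
  rewrite normfV (gtr0_norm (qpoch_gt0 hq _ q1)).
  rewrite (gtr0_norm (_ : 0 < q ^+ 'C(y, 2))) ?exprn_gt0 //.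
  rewrite [leRHS](_ : _ = Dh * (Dp * gauss q (1 + `|a^-1 * b|) z) * (Dq * (DP * (q ^- n) ^+ z))); last first.
    by rewrite gaussM; move: (_ ^+ z) => qz; ring.
  have qi : 0 <= (qpoch q q y)^-1 by rewrite invr_ge0 ltW // qpoch_gt0.
  have pp : 0 <= `|pi_prime q a b z y| * q ^+ 'C(y, 2) by rewrite mulr_ge0 ?exprn_ge0 // ltW.
  apply: ler_pM; rewrite ?(mulr_ge0 _ pp) ?(mulr_ge0 qi) //.
    by apply: ler_pM => //; exact: HDp.
  apply: ler_pM => //; apply: le_trans (HDP y) _; apply: ler_wpM2l => //.
  by rewrite ler_weXn2l.
- have an := gt_eqF a0; have bn := gt_eqF hb; have cn := gt_eqF c0.
  have Bn := gt_eqF B0.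
  have aB : a * - B = - b by rewrite /B; field; rewrite an.
  have GB := gt_eqF (qpoch_inf_gt0 hq NB1).
  have Gc := gt_eqF (qpoch_inf_gt0 hq c1).
  have Gac := gt_eqF (qpoch_inf_gt0 hq ac1).
  have pq w m : w < 1 -> qpoch w q m != 0 by move=> w1; rewrite qpoch_neq0.
  apply: (@cvg_series_shift _ _ x) => [z zx|].
    apply: big1 => y _; by rewrite /Kterm0 [(x <= z)%N]leqNgt zx mul0r.
  (* The prefactor of [v] at [x], times the infinite products of [pi_prime] for [b], divided by
     those of [pi_prime] for [- (a * c)]. *)
  pose cst := (-1) ^+ x * (q ^+ 'C(x, 2) / qpoch q q x) *
    (qpoch_inf c q / qpoch_inf (a * c) q * (qpoch_inf (- b) q / qpoch_inf (- B) q)).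
  rewrite (_ : (fun k => _) = (fun k => cst * (pi_prime q a (- (a * c)) (x + k) x *
      P_qM q n (x + k) (a * - B * q^-1) ((a * - B)^-1 * - (a * c))))); last first.
    apply/funext => k.
    have gE : (a * - B)^-1 * - (a * c) = a * c * b^-1 by rewrite aB; field; rewrite bn.
    rewrite gE -(@pi_qH_P_qM _ _ hq); last 2 first.
    - by move=> m; exact: pq.
    - by move=> m; rewrite aB; exact: pq.
    rewrite !mulr_sumr; apply: eq_bigr => -[y /= yz] _; rewrite ltnS in yz.
    rewrite /Kterm0 yz leq_addr /= /Kterm /v.
    rewrite (_ : - (a^-1 * b * q^-1) = - B * q^-1); last by rewrite /B; ring.
    move: (P_qM _ _ _ _ _) => PP; rewrite !mulrA; congr (_ * PP).
    rewrite /pi_qH /pi_prime !qexpz_sub // -/B (mulrC (- B) a) aB opprK addKn.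
    rewrite (_ : a^-1 * - (a * c) = - c); last by field; rewrite an.
    rewrite opprK (mulrC c a) /cst (exprNn c) (exprNn B).
    (* The sign of [v] at [y] splits into that of [v] at [x] and those of the powers of [- c] and
       [- B]. *)
    have -> : (-1) ^+ y = (-1) ^+ x * (-1) ^+ k * (-1) ^+ (x + k - y) :> R.
      have sk : (x + k = (x + k - y) + y)%N by rewrite subnK.
      by rewrite -exprD [in X in _ = X * _]sk exprD mulrAC -expr2 sqrr_sign mul1r.
    move: ((-1) ^+ x) ((-1) ^+ k) ((-1) ^+ (x + k - y)) => s1 s2 s3; field.
    by rewrite !(qq_neq0 hq) !(qexp_neq0 hq) !pq // GB Gc Gac.
  rewrite (_ : series _ = (fun N => cst * series (fun k => pi_prime q a (- (a * c)) (x + k) x *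
      P_qM q n (x + k) (a * - B * q^-1) ((a * - B)^-1 * - (a * c))) N)); last first.
    by apply/funext => N; rewrite !seriesEnat /= mulr_sumr.
  rewrite (_ : kappa_minus _ _ _ _ _ * _ = cst * (qpoch (- B) q n / qpoch (a * - B) q n *
      P_qM q n x (- B * q^-1) ((a * - B)^-1 * - (a * c)))); last first.
    rewrite /kappa_minus /v aB -/B /cst (_ : (- b)^-1 * - (a * c) = a * c * b^-1); last first.
      by field; rewrite bn.
    rewrite (_ : - (B * q^-1) = - B * q^-1); last by ring.
    by field; rewrite !(qq_neq0 hq) !pq // GB Gac.
  apply: cvgMr; apply: sum_pi_prime_P_qM => //.
  + by rewrite an.
  + by rewrite oppr_eq0 mulf_neq0 // ?an ?cn.
  + by rewrite oppr_eq0 Bn.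
  + by move=> m; rewrite opprK pq.
  + by rewrite mulrN opprK mulKf ?an // Gc.
  + by move=> m; exact: pq.
  + by move=> m; rewrite aB pq.
Qed.

Lemma sum_K_v n x :
  series (fun y => K q a b c x y * v q a b c n y) @ \oo -->
    kappa_minus q a b c n * v q a b c n x.
Proof.
have [_] := sum_Kterm0_v n x.
rewrite (_ : (fun y => limn _) = (fun y => K q a b c x y * v q a b c n y)) //.
by apply/funext => y; apply: cvg_lim => //; exact: K_scale_cvg.
Qed.

(** * Bounds for the eigenvalues *)

Lemma qpoch_inf_ratio w : 0 < w < 1 ->
  0 < qpoch_inf w q / qpoch_inf (a * w) q < 1.
Proof.
case/andP=> w0 w1; have aww : a * w < w by rewrite gtr_pMl.
have aw1 := lt_trans aww w1.
by rewrite divr_gt0 ?qpoch_inf_gt0 //= ltr_pdivrMr ?qpoch_inf_gt0 // mul1r qpoch_inf_lt.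
Qed.

Lemma qpoch_inf_ratio_neg n :
  0 < qpoch_inf (- b * q ^+ n) q / qpoch_inf (- B * q ^+ n) q <= 1.
Proof.
have qn : 0 < q ^+ n by rewrite exprn_gt0.
have N1 w : 0 < w -> - w * q ^+ n < 1.
  by move=> w0; rewrite mulNr ltrNl (lt_trans (ltrN10 _)) // mulr_gt0.
rewrite divr_gt0 ?qpoch_inf_gt0 ?N1 //= ler_pdivrMr ?qpoch_inf_gt0 ?N1 // mul1r.
apply: qpoch_inf_le; rewrite ?N1 // !mulNr lerN2 ler_pM2r //.
by rewrite /B ler_pMl // invf_ge1 // ltW.
Qed.

(** Absorbing the finite symbols into the infinite ones displays the eigenvalue as a ratio strictly
    between 0 and 1 times a ratio in [(0, 1]]. *)
Lemma kappa_minus_ratio n : kappa_minus q a b c n =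
  qpoch_inf c q / qpoch_inf (a * c) q *
  (qpoch_inf (- b * q ^+ n) q / qpoch_inf (- B * q ^+ n) q).
Proof.
rewrite /kappa_minus -/B (qpoch_inf_split hq (- b) n) (qpoch_inf_split hq (- B) n).
have Gac := gt_eqF (qpoch_inf_gt0 hq ac1).
have GB : qpoch_inf (- B * q ^+ n) q != 0.
  have := gt_eqF (qpoch_inf_gt0 hq NB1); rewrite (qpoch_inf_split hq _ n) mulf_eq0.
    by move=> /negbT; rewrite negb_or => /andP[].
by field; rewrite Gac GB !qpoch_neq0.
Qed.

Lemma kappa_minus_lt1 n : 0 < kappa_minus q a b c n < 1.
Proof.
rewrite kappa_minus_ratio.
have /andP[r0 r1] := qpoch_inf_ratio hc; have /andP[s0 s1] := qpoch_inf_ratio_neg n.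
rewrite mulr_gt0 //=; apply: le_lt_trans r1.
by rewrite ler_piMr // ltW.
Qed.

Lemma kappa_ratio_lt1 n : 0 < kappa_minus q a b c n / kappa q a c n < 1.
Proof.
have qn : 0 < q ^+ n by rewrite exprn_gt0.
have cn : 0 < c * q ^+ n < 1.
  rewrite mulr_gt0 //=; apply: le_lt_trans c1.
  by rewrite ler_piMr ?(ltW c0) // exprn_ile1 // ltW.
have acn : a * c * q ^+ n < 1.
  by case/andP: cn => cn0 cn1; rewrite -mulrA (lt_trans _ cn1) // gtr_pMl.
rewrite (_ : _ / _ = qpoch_inf (c * q ^+ n) q / qpoch_inf (a * (c * q ^+ n)) q *
  (qpoch_inf (- b * q ^+ n) q / qpoch_inf (- B * q ^+ n) q)); last first.
  rewrite kappa_minus_ratio /kappa (qpoch_inf_split hq c n) (qpoch_inf_split hq (a * c) n) (mulrA a c).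
  have Gac := gt_eqF (qpoch_inf_gt0 hq acn).
  have GB : qpoch_inf (- B * q ^+ n) q != 0.
    have := gt_eqF (qpoch_inf_gt0 hq NB1); rewrite (qpoch_inf_split hq _ n) mulf_eq0.
    by move=> /negbT; rewrite negb_or => /andP[].
  by field; rewrite Gac GB !qpoch_neq0.
have /andP[r0 r1] := qpoch_inf_ratio cn; have /andP[s0 s1] := qpoch_inf_ratio_neg n.
rewrite mulr_gt0 //=; apply: le_lt_trans r1.
by rewrite ler_piMr // ltW.
Qed.

(** At [x = 0] the symbol [(1;q)_k] vanishes for [k > 0], so the sum reduces to 1; the eigenvectors
    are therefore not trivial. *)
Lemma v0_neq0 n : v q a b c n 0 != 0.
Proof.
rewrite /v bin0n /P_qM big_nat_recl //= big1_seq => [|k _].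
  by rewrite !qpoch0 !expr0 !(mulr1, invr1, addr0) oner_neq0.
by rewrite (@qpoch_qVn0 _ _ hq 0) // mulr0 !mul0r.
Qed.

End Kernel.

Theorem mainTheorem9 (R : realType) (q a b c : R)
    (hq : 0 < q < 1) (ha : 0 < a < 1) (hb : 0 < b) (hc : 0 < c < 1) :
  let pi x := pi_qM q x (c * q^-1) ((a * c)^-1 * b) in
  let P n x := P_qM q n x (c * q^-1) ((a * c)^-1 * b) in
  (forall x y : nat,
    cvgn (fun m => \sum_(maxn x y <= z < m) Kterm q a b c x y z)) /\
  (forall x y : nat, 0 <= K q a b c x y) /\
  (forall y : nat, series (fun x => K q a b c x y) @ \oo --> (1 : R)) /\
  (forall x y : nat, K q a b c x y * pi y = K q a b c y x * pi x) /\
  (forall n x : nat,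
    series (fun y => K q a b c x y * pi y * P n y) @ \oo -->
      kappa q a c n * pi x * P n x) /\
  (forall n : nat, exists x : nat, v q a b c n x != 0) /\
  (forall n x : nat,
    series (fun y => K q a b c x y * v q a b c n y) @ \oo -->
      kappa_minus q a b c n * v q a b c n x) /\
  (forall n : nat, 0 < kappa_minus q a b c n < 1) /\
  (forall n : nat, 0 < kappa_minus q a b c n / kappa q a c n < 1).
Proof.
move=> pi P.
have sumP n y := @sum_K_P _ _ _ _ _ hq ha hb hc n y.
split; first by move=> x y; rewrite Kterm0_seriesE; apply/cvg_ex; eexists; exact: K_cvg.
split; first exact: K_ge0.
split.
  (* Normalization is the case [n = 0]: the constant function, with eigenvalue 1. *)
  move=> y; have := sumP 0 y.
  rewrite P_qM0 mulr1 /kappa !qpoch0 invr1 mulr1.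
  by under eq_fun do rewrite P_qM0 mulr1.
split; first exact: K_sym.
split.
  (* Detailed balance moves the weight to [pi x] and turns the row sum into the column sum already
     known. *)
  move=> n x; rewrite (_ : series _ = (fun N => pi x *
      series (fun y => K q a b c y x * P n y) N)); last first.
    apply/funext => N; rewrite !seriesEnat /= mulr_sumr; apply: eq_bigr => y _.
    have -> : K q a b c x y * pi y = K q a b c y x * pi x by exact: K_sym.
    by move: (pi x) (P n y) => p r; ring.
  rewrite [X in _ --> X](_ : _ = pi x * (kappa q a c n * P n x)); last first.
    by move: (pi x) (P n x) => p r; ring.
  by apply: cvgMr; exact: sumP.
split; first by move=> n; exists 0%N; exact: v0_neq0.
split; first exact: sum_K_v.
by split; [exact: kappa_minus_lt1|exact: kappa_ratio_lt1].
Qed.
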